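(* Let $\mathcal{A}_M$ be an algorithm that, for an input graph $G$ with $n$ vertices, runs in $T$ rounds of the semi-MPC model. Then $\mathcal{A}_M$ can be simulated in $O(T)$ rounds of the congested clique model.
   Context: A word is $O(\log n)$ bits, and each message consists of one word. Semi-MPC model: the input is a graph $G=(V,E)$ with $n=|V|$ and $m=|E|$, whose edges are initially distributed adversarially among $p$ machines, each with local space $s=O(n)$ words. The number of machines satisfies $p\le s$, and the total space $p\cdot s$ is $\widetilde{O}(\ell^{1+\delta})$, where $\ell$ is the input size and $\delta\in[0,1)$ is a small parameter of the algorithm. Computation proceeds in synchronous rounds: in each round every machine performs a local computation on its data and, at the end of the round, communicates with other machines. The total size of the messages that a machine sends in a round, and the total size it receives in a round, must not exceed its space $s$. Congested clique model: the input is a graph $G=(V,E)$ with $n=|V|$. There is one computing node for each vertex, and each node is initially aware of its incident edges. Computation proceeds in synchronous rounds; in each round, every node performs local computation, and every (ordered) pair of nodes, even if not adjacent in $G$, can exchange a message of $O(\log n)$ bits. There is no restriction on the local memory or local computation of a node. Simulating an algorithm $\mathcal{A}$ means running an algorithm in the target model that, on every input graph, produces an output that $\mathcal{A}$ produces on that graph (for some admissible initial distribution of the input). The number of rounds of the simulation is counted in the target model. *)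

(* Defs.v *)
From mathcomp Require Import all_boot all_order all_algebra.
From mathcomp Require Import reals exp.

Set Implicit Arguments.
Unset Strict Implicit.
Unset Printing Implicit Defensive.

Import Order.TTheory GRing.Theory Num.Theory.

(* The number of bits needed to write any of 0, ..., n. It is Theta(log n) and,
   unlike log n itself, does not vanish at n = 1. *)
Definition logw (n : nat) : nat := up_log 2 n.+1.

Definition word (w : nat) := w.-tuple bool.

Record sgraph (n : nat) := SGraph {
  adj :> rel 'I_n;
  adj_sym : symmetric adj;
  adj_irr : irreflexive adj
}.

(* The undirected edge {u, v} is represented by the pair (u, v) with u < v. *)
Definition edges n (G : sgraph n) : {set 'I_n * 'I_n} :=
  [set e : 'I_n * 'I_n | (e.1 < e.2) && adj G e.1 e.2].

Definition nb_edges n (G : sgraph n) : nat := #|edges G|.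

Definition neighbours n (G : sgraph n) (v : 'I_n) : {set 'I_n} :=
  [set u | adj G v u].

(* The words held by one machine between two rounds: those it kept in its
   memory, and, for each sender, the list of one-word messages just received. *)
Definition mpc_data (p w : nat) : Type :=
  (seq (word w) * {ffun 'I_p -> seq (word w)})%type.

Definition inbox_size p w (d : mpc_data p w) : nat := \sum_(j < p) size (d.2 j).

Definition data_size p w (d : mpc_data p w) : nat := size d.1 + inbox_size d.

(* Local computation is unrestricted. [mpc_load] reads the edges initially
   placed on a machine into its memory. In round t machine i holding the data d
   keeps [mpc_keep t i d] and sends the list [mpc_send t i d j] to machine j.
   The items output by machine i are read off its final data. *)
Record mpc_alg (Out : Type) (n : nat) := MpcAlg {
  mpc_p : nat;  (* number of machines *)
  mpc_s : nat;  (* local space, in words *)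
  mpc_w : nat;  (* bits per word *)
  mpc_load : 'I_mpc_p -> {set 'I_n * 'I_n} -> seq (word mpc_w);
  mpc_keep : nat -> 'I_mpc_p -> mpc_data mpc_p mpc_w -> seq (word mpc_w);
  mpc_send : nat -> 'I_mpc_p -> mpc_data mpc_p mpc_w ->
             'I_mpc_p -> seq (word mpc_w);
  mpc_out : 'I_mpc_p -> mpc_data mpc_p mpc_w -> seq Out
}.

Section MpcRun.
Variables (Out : Type) (n : nat) (A : mpc_alg Out n).

Definition distribution := 'I_(mpc_p A) -> {set 'I_n * 'I_n}.

(* Each edge is on exactly one machine, and no machine holds more edges than its
   space allows; an edge is O(log n) bits and counts as one word. *)
Definition admissible (G : sgraph n) (D : distribution) : Prop :=
  [/\ forall i, D i \subset edges G,
      forall e, e \in edges G -> exists! i, e \in D i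
    & forall i, #|D i| <= mpc_s A].

Fixpoint mpc_run (D : distribution) (t : nat) :
    'I_(mpc_p A) -> mpc_data (mpc_p A) (mpc_w A) :=
  match t with
  | 0 => fun i => (mpc_load i (D i), [ffun => [::]])
  | t'.+1 => fun i =>
      (mpc_keep t' i (mpc_run D t' i),
       [ffun j => mpc_send t' j (mpc_run D t' j) i])
  end.

Definition respects_space (D : distribution) (T : nat) : Prop :=
  [/\ forall t i, t <= T -> data_size (mpc_run D t i) <= mpc_s A,
      forall t i, t < T ->
        \sum_(j < mpc_p A) size (mpc_send t i (mpc_run D t i) j) <= mpc_s A
    & forall t i, t <= T -> inbox_size (mpc_run D t i) <= mpc_s A].

(* The output of the whole system, as a list up to permutation. *)
Definition mpc_output (D : distribution) (T : nat) : seq Out :=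
  flatten [seq mpc_out i (mpc_run D T i) | i <- enum 'I_(mpc_p A)].

End MpcRun.

(* An algorithm of the semi-MPC model consists of a program for each number n of
   vertices and number m of edges: the number of machines depends on the input
   size. Only the pairs (n, m) realised by a graph are constrained. The constants
   a and c are those hidden in the word size O(log n) and in the space O(n); the
   input size is l = n + m. *)
Record semi_mpc (R : realType) (delta : R) (a c : nat) (Out : Type)
    (A : forall n m : nat, mpc_alg Out n) (T : nat -> nat) : Prop := SemiMpc {
  semi_mpc_word : forall n (G : sgraph n),
    mpc_w (A n (nb_edges G)) <= a * logw n;
  semi_mpc_space : forall n (G : sgraph n),
    mpc_s (A n (nb_edges G)) <= c * n;
  semi_mpc_machines : forall n (G : sgraph n),
    mpc_p (A n (nb_edges G)) <= mpc_s (A n (nb_edges G));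
  semi_mpc_total : exists K k : nat, forall n (G : sgraph n),
    let m := nb_edges G in
    let l := n + m in
    ((mpc_p (A n m) * mpc_s (A n m))%:R
       <= (K * logw l ^ k)%:R * powR l%:R (1 + delta) :> R)%R;
  (* The machines together can hold the input. *)
  semi_mpc_capacity : forall n (G : sgraph n),
    let m := nb_edges G in m <= mpc_p (A n m) * mpc_s (A n m);
  (* The model is respected during T n rounds on every n-vertex graph, however
     its edges are initially distributed. *)
  semi_mpc_rounds : forall n (G : sgraph n)
      (D : distribution (A n (nb_edges G))),
    admissible G D -> respects_space D (T n)
}.

(* b is the number of bits of a message. Each node initially knows its own name
   and its neighbours; in every round it sends at most one message to each node
   and updates its state from the messages that it receives. *)
Record cc_alg (Out : Type) (n b : nat) := CcAlg {
  cc_state : Type;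
  cc_init : 'I_n -> {set 'I_n} -> cc_state;
  cc_send : 'I_n -> cc_state -> 'I_n -> option (word b);
  cc_recv : 'I_n -> cc_state -> {ffun 'I_n -> option (word b)} -> cc_state;
  cc_out : 'I_n -> cc_state -> seq Out
}.

Section CcRun.
Variables (Out : Type) (n b : nat) (B : cc_alg Out n b).

Fixpoint cc_run (G : sgraph n) (t : nat) : 'I_n -> cc_state B :=
  match t with
  | 0 => fun v => cc_init B v (neighbours G v)
  | t'.+1 => fun v =>
      cc_recv v (cc_run G t' v) [ffun u => cc_send u (cc_run G t' u) v]
  end.

Definition cc_output (G : sgraph n) (t : nat) : seq Out :=
  flatten [seq cc_out v (cc_run G t v) | v <- enum 'I_n].

End CcRun.

(* On every graph, B outputs after r n rounds the same items as A does after T n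
   rounds from some admissible initial distribution of the edges. *)
Definition simulates (Out : eqType) (b : nat -> nat)
    (B : forall n, cc_alg Out n (b n)) (r : nat -> nat)
    (A : forall n m : nat, mpc_alg Out n) (T : nat -> nat) : Prop :=
  forall n (G : sgraph n),
    exists2 D : distribution (A n (nb_edges G)),
      admissible G D & perm_eq (cc_output (B n) G (r n)) (mpc_output D (T n)).

(* Main.v *)
Require Import Defs.
From mathcomp Require Import all_boot all_order all_algebra.
From mathcomp Require Import reals exp.
From mathcomp Require Import boolp zify.

(* Each machine is placed on its own node of a virtual clique of q * q = O(n)
   nodes, O(1) of them per real node, so that a round of the semi-MPC model becomes
   a routing problem in which every node sends and receives at most q * q packets.
   It is solved in O(1) rounds as in Lenzen's theorem, with the virtual nodes
   arranged in q groups of q nodes. First, every node deals its packets for each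
   destination group round-robin to the q groups; every group then holds O(q * q)
   packets for each destination group. Next, the packets of group f for group h are
   collected at the node (h, f), and finally delivered within group h. In both of
   these phases a group has q sources and q targets of load O(q * q), and can learn
   its q * q demands through the other nodes; a bipartite edge colouring with
   O(q * q) colours, chosen greedily and identically by all members, gives the
   relay of each packet. The initial distribution of the edges is another instance
   of routing, once the up-degrees have been broadcast. *)

Set Implicit Arguments.
Unset Strict Implicit.
Unset Printing Implicit Defensive.

(** * Protocols of the clique and their composition *)

Section Clique.
Variables (n b : nat).

Definition inbox : Type := {ffun 'I_n -> option (word b)}.

(** Memory is unlimited, so a node can keep all that it has received: its messages depend on its
    initial knowledge and on the past inboxes, whose number gives the round. *)
Definition protocol (V : Type) : Type :=
  'I_n -> V -> seq inbox -> 'I_n -> option (word b).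

Fixpoint history I V (P : protocol V) (X0 : I -> 'I_n -> V) (i : I) (t : nat) :
    'I_n -> seq inbox :=
  match t with
  | 0 => fun=> [::]
  | t'.+1 => fun v => rcons (history P X0 i t' v)
                        [ffun u => P u (X0 i u) (history P X0 i t' u) v]
  end.

(* The index i ranges over the possible inputs, X0 i v and X i v are what the node
   v knows about i before and after the r rounds. *)
Definition computes I V S (X0 : I -> 'I_n -> V) (r : nat) (X : I -> 'I_n -> S) :=
  exists (P : protocol V) (f : 'I_n -> V -> seq inbox -> S),
    forall i v, f v (X0 i v) (history P X0 i r v) = X i v.

Lemma size_history I V (P : protocol V) (X0 : I -> 'I_n -> V) i t v :
  size (history P X0 i t v) = t.
Proof. by elim: t v => [|t IH] v //=; rewrite size_rcons IH. Qed.

Lemma computes_map I V S (X0 : I -> 'I_n -> V) (X : I -> 'I_n -> S)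
    (g : 'I_n -> V -> S) :
  (forall i v, X i v = g v (X0 i v)) -> computes X0 0 X.
Proof. by move=> Xg; exists (fun _ _ _ _ => None), (fun v x _ => g v x). Qed.

Lemma computes_trans I V1 V2 V3 (X1 : I -> 'I_n -> V1) (X2 : I -> 'I_n -> V2)
    (X3 : I -> 'I_n -> V3) r1 r2 :
  computes X1 r1 X2 -> computes X2 r2 X3 -> computes X1 (r1 + r2) X3.
Proof.
case=> [P1 [f1 f1X]] [P2 [f2 f2X]].
(* The length of the history tells which protocol is running; the second one starts from what [f1]
   extracts from the first [r1] inboxes. *)
pose P : protocol V1 := fun v x h =>
  if size h < r1 then P1 v x h else P2 v (f1 v x (take r1 h)) (drop r1 h).
exists P, (fun v x h => f2 v (f1 v x (take r1 h)) (drop r1 h)).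
have hist1 i t v : t <= r1 -> history P X1 i t v = history P1 X1 i t v.
  elim: t v => [|t IH] v //= lt_t; rewrite IH 1?ltnW //; congr rcons.
  by apply/ffunP=> u; rewrite !ffunE /P size_history lt_t IH 1?ltnW.
have hist2 i t v : history P X1 i (r1 + t) v =
    history P1 X1 i r1 v ++ history P2 X2 i t v.
  elim: t v => [|t IH] v; first by rewrite addn0 hist1 // cats0.
  rewrite addnS /= IH -rcons_cat; congr rcons.
  apply/ffunP=> u; rewrite !ffunE /P size_history ltnNge leq_addr /= IH.
  by rewrite take_size_cat ?drop_size_cat ?size_history // f1X.
move=> i v; rewrite hist2 take_size_cat ?drop_size_cat ?size_history //.
by rewrite f1X f2X.
Qed.

(** When every node can compute the parameter [k i], all of them select the protocol made for that
    value. *)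
Lemma computes_fiber I V S K (k : I -> K) (X0 : I -> 'I_n -> V) (g : V -> K)
    (X : I -> 'I_n -> S) r :
  (forall i v, g (X0 i v) = k i) ->
  (forall k0, computes (fun i : {i | k i = k0} => X0 (sval i)) r
                       (fun i => X (sval i))) ->
  computes X0 r X.
Proof.
move=> gX0 comp.
have [P {comp}] := choice comp.
move=> /choice[f fX].
exists (fun v x => P (g x) v x), (fun v x => f (g x) v x) => i v.
rewrite gX0 -[RHS](fX (k i) (exist _ i erefl)) /=; congr f.
elim: {fX}r v => [|t IH] v //=; rewrite IH; congr rcons.
by apply/ffunP=> u; rewrite !ffunE gX0 IH.
Qed.

Lemma computes_step I S (X : I -> 'I_n -> S) (M : finType)
    (msg : 'I_n -> S -> 'I_n -> M) r :
  #|M| <= (2 ^ b) ^ r ->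
  computes X r (fun i v => (X i v, [ffun u => msg u (X i u) v])).
Proof.
move=> leM.
have leMC : #|M| <= #|{: r.-tuple (word b)}| by rewrite !card_tuple card_bool.
(* A message is coded by [r] words, sent one per round. *)
pose enc (x : M) : r.-tuple (word b) := enum_val (widen_ord leMC (enum_rank x)).
have enc_inj : injective enc.
  move=> x y /enum_val_inj/(congr1 val)/= /val_inj; exact: enum_rank_inj.
pose snd u s v t : option (word b) := onth (enc (msg u s v)) t.
exists (fun u s h v => snd u s v (size h)).
(* The default [msg v s v] only provides an element of [M]; the words received always decode. *)
exists (fun v s h => (s, [ffun u => odflt (msg v s v)
  [pick x | [seq Some y | y <- enc x] == [seq (y : inbox) u | y <- h]]])).
move=> i v; congr pair; apply/ffunP=> u; rewrite !ffunE.
have -> t : history (fun u s h v => snd u s v (size h)) X i t v =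
    mkseq (fun t => [ffun u => snd u (X i u) v t]) t.
  elim: t v => [|t IH] v //=; rewrite IH mkseqS; congr rcons.
  by apply/ffunP=> u'; rewrite !ffunE size_history.
set h := map _ (mkseq _ _).
have hE x : ([seq Some y | y <- enc x] == h) = (x == msg u (X i u) v).
  have -> : h = [seq Some y | y <- enc (msg u (X i u) v)].
    apply: (@eq_from_nth _ None); rewrite /h !size_map size_iota ?size_tuple //.
    move=> t lt_t; rewrite -map_comp (nth_map 0) ?size_iota //= ffunE nth_iota //.
    by rewrite /snd onthE.
  rewrite (inj_eq (inj_map _)); last by move=> ? ? [].
  by rewrite val_eqE (inj_eq enc_inj).
case: pickP => [x|/(_ (msg u (X i u) v))]; rewrite hE ?eqxx //.
by move/eqP.
Qed.

End Clique.

Lemma computes_cc n b (Out : Type) r (X : sgraph n -> 'I_n -> seq Out) :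
  @computes n b _ _ _ (@neighbours n) r X ->
  exists B : cc_alg Out n b,
    forall G v, cc_out v (cc_run B G r v) = X G v.
Proof.
case=> P [f fX].
exists {| cc_state := {set 'I_n} * seq (inbox n b);
  cc_init := fun _ N => (N, [::]);
  cc_send := fun v x u => P v x.1 x.2 u;
  cc_recv := fun _ x h => (x.1, rcons x.2 h);
  cc_out := fun v x => f v x.1 x.2 |} => G v /=; rewrite -fX.
set B := CcAlg _ _ _ _.
suff -> t : cc_run B G t = fun v => (neighbours G v, history P (@neighbours n) G t v).
  by [].
elim: t => [//|t IH] /=; rewrite IH /=; apply/funext=> {}v.
by congr (_, rcons _ _); apply/ffunP=> u; rewrite !ffunE.
Qed.

(** * Fibres, ranks and bipartite edge colouring *)

Lemma card_fibres (T U : finType) (A : {set T}) (g : T -> U) :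
  #|A| = \sum_u #|[set x in A | g x == u]|.
Proof.
rewrite -sum1_card (partition_big g xpredT) //=.
by apply: eq_bigr => u _; rewrite -sum1_card; apply: eq_bigl => x; rewrite inE.
Qed.

Lemma card_inj_leq (T U : finType) (A : {set T}) (g : T -> U) :
  {in A &, injective g} -> #|A| <= #|U|.
Proof. by move=> /card_in_imset <-; apply: max_card. Qed.

Definition rank (T : finType) (A : {set T}) (x : T) : nat := index x (enum A).

Lemma rank_ltn (T : finType) (A : {set T}) x : x \in A -> rank A x < #|A|.
Proof. by move=> Ax; rewrite cardE index_mem mem_enum. Qed.

Lemma rank_inj (T : finType) (A : {set T}) x y :
  x \in A -> y \in A -> rank A x = rank A y -> x = y.
Proof. by move=> Ax Ay; apply: index_inj; rewrite ?mem_enum. Qed.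

Lemma rank_surj (T : finType) (A : {set T}) t :
  t < #|A| -> exists2 x, x \in A & rank A x = t.
Proof.
rewrite cardE; case E: (enum A) => [//|x0 s0]; rewrite -E => lt_t.
exists (nth x0 (enum A) t); first by rewrite -mem_enum mem_nth.
by rewrite /rank index_uniq ?enum_uniq.
Qed.

(* Greedily: when x is coloured, at most 2(d - 1) colours are forbidden. *)
Lemma bipartite_colouring (T C : finType) (L R : eqType) (l : T -> L) (r : T -> R)
    (E : {set T}) (d : nat) (c0 : {ffun T -> C}) :
  (forall x, x \in E -> #|[set y in E | l y == l x]| <= d) ->
  (forall x, x \in E -> #|[set y in E | r y == r x]| <= d) ->
  2 * d <= #|C| ->
  exists c : {ffun T -> C}, {in E &, forall x y,
    (l x == l y) || (r x == r y) -> c x = c y -> x = y}.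
Proof.
move En: #|E| => m; elim: m E En => [|m IH] E En dl dr dC.
  by exists c0 => x y; rewrite (cards0_eq En) inE.
have /card_gt0P[x Ex] : 0 < #|E| by rewrite En.
have subE : E :\ x \subset E := subD1set E x.
have {}IH : exists c : {ffun T -> C}, {in E :\ x &, forall x y,
    (l x == l y) || (r x == r y) -> c x = c y -> x = y}.
  apply: IH => //.
  - by apply/eqP; rewrite -eqSS -En (cardsD1 x E) Ex.
  - move=> y /(subsetP subE)/dl; apply: leq_trans; apply: subset_leq_card.
    by apply/subsetP=> z; rewrite !inE => /andP[/andP[_ ->] ->].
  - move=> y /(subsetP subE)/dr; apply: leq_trans; apply: subset_leq_card.
    by apply/subsetP=> z; rewrite !inE => /andP[/andP[_ ->] ->].
case: IH => c cP.
pose F := c @: [set y in E :\ x | l y == l x] :|: c @: [set y in E :\ x | r y == r x].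
have {dl} dl : #|[set y in E :\ x | l y == l x]| < d.
  apply: leq_trans (dl x Ex); rewrite [X in _ < X](cardsD1 x) inE Ex eqxx /= ltnS.
  by apply: subset_leq_card; apply/subsetP=> z; rewrite !inE -andbA.
have {dr} dr : #|[set y in E :\ x | r y == r x]| < d.
  apply: leq_trans (dr x Ex); rewrite [X in _ < X](cardsD1 x) inE Ex eqxx /= ltnS.
  by apply: subset_leq_card; apply/subsetP=> z; rewrite !inE -andbA.
have /card_gt0P[k] : 0 < #|~: F|.
  have : #|F| < #|C|.
    apply: leq_ltn_trans (leq_card_setU _ _) _; apply: leq_trans dC.
    by rewrite mul2n -addnn -addSn leq_add ?(leq_ltn_trans (leq_imset_card _ _)) //
      (leq_trans (leq_imset_card _ _)) // ltnW.
  by rewrite -(cardsC F) -[X in X < _]addn0 ltn_add2l.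
rewrite !inE => /norP[kl kr].
have kP y : y \in E -> y != x -> (l y == l x) || (r y == r x) -> c y != k.
  move=> Ey yx /orP[lr|lr].
    by apply: contraNneq kl => <-; apply: imset_f; rewrite !inE yx Ey.
  by apply: contraNneq kr => <-; apply: imset_f; rewrite !inE yx Ey.
exists [ffun y => if y == x then k else c y] => y z Ey Ez; rewrite !ffunE.
case: (eqVneq y x) (eqVneq z x) => [->|yx] [->|zx] //.
- by rewrite (eq_sym (l x)) (eq_sym (r x)) => /(kP z Ez zx)/eqP ckz kz; case: ckz.
- by move=> /(kP y Ey yx)/eqP.
- by apply: cP; rewrite !inE ?yx ?zx.
Qed.

(** * Virtual nodes hosted by the real nodes *)

Section VirtualNodes.
Variables (n b k : nat) (W : finType) (host : W -> 'I_n * 'I_k).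
Hypothesis host_inj : injective host.

(** [host w = (v, j)] places [w] in slot [j] of the node [v]; an empty slot holds [None]. *)
Definition hosted I S (X : I -> W -> S) (i : I) (v : 'I_n) : {ffun 'I_k -> option S} :=
  [ffun j => omap (X i) [pick w | host w == (v, j)]].

Definition vcomputes I S S' (X : I -> W -> S) (r : nat) (Y : I -> W -> S') :=
  computes b (hosted X) r (hosted Y).

Lemma vcomputes_map I S S' (X : I -> W -> S) (Y : I -> W -> S') (g : W -> S -> S') :
  (forall i w, Y i w = g w (X i w)) -> vcomputes X 0 Y.
Proof.
move=> Yg; apply: (computes_map _ (g := fun v (x : {ffun 'I_k -> option S}) => [ffun j =>
  if [pick w | host w == (v, j)] is Some w then omap (g w) (x j) else None])).
move=> i v; apply/ffunP=> j; rewrite !ffunE; case: pickP => //= w _.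
by rewrite Yg.
Qed.

Lemma vcomputes_trans I S1 S2 S3 (X1 : I -> W -> S1) (X2 : I -> W -> S2)
    (X3 : I -> W -> S3) r1 r2 :
  vcomputes X1 r1 X2 -> vcomputes X2 r2 X3 -> vcomputes X1 (r1 + r2) X3.
Proof. exact: computes_trans. Qed.

(** One real message bundles the messages for the [k * k] pairs of slots, each possibly absent,
    which explains the size of the alphabet. *)
Lemma vcomputes_step I S (X : I -> W -> S) (M : finType) (msg : W -> S -> W -> M) r :
  #|M|.+1 ^ (k * k) <= (2 ^ b) ^ r ->
  vcomputes X r (fun i w => (X i w, [ffun u => msg u (X i u) w])).
Proof.
move=> leM; rewrite /vcomputes -[r]addn0.
pose pmsg (v : 'I_n) (x : {ffun 'I_k -> option S}) (v' : 'I_n) :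
    {ffun 'I_k * 'I_k -> option M} := [ffun j =>
  if [pick w | host w == (v, j.1)] is Some w then
    if [pick w | host w == (v', j.2)] is Some w' then
      omap (fun s => msg w s w') (x j.1)
    else None
  else None].
apply: computes_trans; first apply: (computes_step _ pmsg).
  by rewrite card_ffun card_option card_prod card_ord.
apply: (computes_map _ (g := fun v (x : {ffun 'I_k -> option S} *
  {ffun 'I_n -> {ffun 'I_k * 'I_k -> option M}}) => [ffun j =>
  if [pick w | host w == (v, j)] is Some w then
    omap (fun s => (s, [ffun u => odflt (msg w s w) (x.2 (host u).1 ((host u).2, j))]))
      (x.1 j)
  else None])).
move=> i v; apply/ffunP=> j; rewrite !ffunE /=; case: pickP => [w /eqP hw|//] /=.
congr (Some (_, _)); apply/ffunP=> u; rewrite !ffunE /=.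
case: pickP => [u' /eqP hu|/(_ u)]; last by rewrite -surjective_pairing eqxx.
have -> : u' = u by apply: host_inj; rewrite hu -surjective_pairing.
case: pickP => [w' /eqP hw'|/(_ w)]; last by rewrite hw eqxx.
have -> : w' = w by apply: host_inj; rewrite hw hw'.
by [].
Qed.

(** Up to four packets travel as one message with four optional fields. *)
Lemma vcomputes_hop I S (X : I -> W -> S) (P : finType) (out : W -> S -> W -> {set P}) r :
  (forall i u w, #|out u (X i u) w| <= 4) ->
  (#|P|.+1 ^ 4).+1 ^ (k * k) <= (2 ^ b) ^ r ->
  vcomputes X r (fun i w => (X i w, [ffun u => out u (X i u) w])).
Proof.
move=> out4 leP; rewrite -[r]addn0.
pose msg u s w : {ffun 'I_4 -> option P} := [ffun j : 'I_4 => onth (enum (out u s w)) j].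
apply: vcomputes_trans; first apply: (vcomputes_step _ msg).
  by rewrite card_ffun card_option card_ord.
apply: (vcomputes_map (g := fun w (x : S * {ffun W -> {ffun 'I_4 -> option P}}) =>
  (x.1, [ffun u => [set p : P | Some p \in codom (x.2 u)]]))).
move=> i w; congr pair; apply/ffunP=> u; rewrite !ffunE; apply/setP=> p; rewrite inE.
apply/idP/codomP => /= [up|[j]]; last first.
  rewrite ffunE => /esym E; rewrite -mem_enum -(onth_nth p _ _ _ E) mem_nth //.
  by rewrite -onthTE E.
have lt_p : index p (enum (out u (X i u) w)) < #|out u (X i u) w|.
  by rewrite cardE index_mem mem_enum.
exists (Ordinal (leq_trans lt_p (out4 i u w))); rewrite ffunE /= onthE.
by rewrite (nth_map p) ?index_mem ?mem_enum // nth_index ?mem_enum.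
Qed.

End VirtualNodes.

(** * Colouring the packets of a group *)

(* The node (f, j) is the j-th member of group f. *)
Section GroupColouring.
Variables (q : nat) (P : finType) (A : {set P}) (loc : P -> 'I_q * 'I_q) (key : P -> 'I_q).

(** An item [(j, h, t)] names the [t]-th packet with key [h] at member [j]: an edge of the bipartite
    multigraph between members and keys. *)
Definition item : finType := ('I_q * 'I_q * 'I_(2 * (q * q)).+1)%type.

Definition counts : finType := {ffun 'I_q * 'I_q -> 'I_(2 * (q * q)).+1}.

Definition items (z : counts) : {set item} := [set x : item | x.2 < z x.1].

Definition proper (z : counts) (c : {ffun item -> 'I_q * 'I_q * 'I_4}) : bool :=
  [forall x in items z, forall y in items z,
    ((x.1.1 == y.1.1) || (x.1.2 == y.1.2)) && (c x == c y) ==> (x == y)].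

(** Being a function of the counts alone, it is the same for all members that know them. A colour is
    a relay with one of four labels, which gives 4q^2 colours, twice the maximal degree 2q^2. *)
Definition colouring (z : counts) : {ffun item -> 'I_q * 'I_q * 'I_4} :=
  odflt [ffun x => (x.1, ord0)] [pick c | proper z c].

Definition group_counts (f : 'I_q) : counts :=
  [ffun x => inord #|[set p in [set p in A | loc p == (f, x.1)] | key p == x.2]|].

(* The packets of a node with the same key are interchangeable for the colouring,
   so that it only depends on the counts. *)
Definition item_of (H : {set P}) (j : 'I_q) (p : P) : item :=
  (j, key p, inord (rank [set p' in H | key p' == key p] p)).

Definition packet_item (p : P) : item :=
  item_of [set p' in A | loc p' == loc p] (loc p).2 p.

Definition relay (p : P) : 'I_q * 'I_q :=
  (colouring (group_counts (loc p).1) (packet_item p)).1.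

Hypothesis node_load : forall u, #|[set p in A | loc p == u]| <= 2 * (q * q).
Hypothesis key_load : forall f j,
  #|[set p in A | ((loc p).1 == f) && (key p == j)]| <= 2 * (q * q).

Let cell_load (u : 'I_q * 'I_q) (j : 'I_q) :
  #|[set p in [set p in A | loc p == u] | key p == j]| < (2 * (q * q)).+1.
Proof.
rewrite ltnS (leq_trans _ (node_load u)) // subset_leq_card //.
by apply/subsetP=> p; rewrite inE => /andP[].
Qed.

Let rank_cell p : p \in A ->
  rank [set p' in [set p' in A | loc p' == loc p] | key p' == key p] p <
  #|[set p' in [set p' in A | loc p' == loc p] | key p' == key p]|.
Proof. by move=> Ap; rewrite rank_ltn // !inE Ap !eqxx. Qed.

Lemma packet_item_in p : p \in A -> packet_item p \in items (group_counts (loc p).1).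
Proof.
move=> Ap; rewrite !inE /= ffunE /= -surjective_pairing !inordK ?rank_cell //.
exact: ltn_trans (rank_cell Ap) _.
Qed.

Lemma packet_item_inj : {in A &, forall p p', (loc p).1 = (loc p').1 ->
  packet_item p = packet_item p' -> p = p'}.
Proof.
move=> p p' Ap Ap' eq1 [eq2 eqk].
have eql : loc p = loc p' by rewrite [LHS]surjective_pairing eq1 eq2 -surjective_pairing.
move/(congr1 (@nat_of_ord _)); rewrite !inordK ?(ltn_trans (rank_cell _) (cell_load _ _)) //.
by rewrite eql eqk => /rank_inj; apply; rewrite !inE ?Ap ?Ap' ?eql ?eqk !eqxx.
Qed.

Lemma packet_item_surj f x : x \in items (group_counts f) ->
  exists2 p, p \in A & (loc p).1 = f /\ packet_item p = x.
Proof.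
case: x => [[j k] t]; rewrite !inE /= ffunE inordK //= => /rank_surj[p].
rewrite !inE => /andP[/andP[Ap /eqP lp] /eqP kp] rk; exists p => //.
split; first by rewrite lp.
rewrite /packet_item /item_of lp kp; congr (_, _, _); apply: val_inj.
by rewrite /= rk inordK.
Qed.

(** Items correspond one-to-one to the packets of the group, so the degrees in the multigraph are
    the loads of nodes and keys, and the greedy colouring applies. *)
Lemma colouringP f : {in items (group_counts f) &, forall x y,
  (x.1.1 == y.1.1) || (x.1.2 == y.1.2) ->
  colouring (group_counts f) x = colouring (group_counts f) y -> x = y}.
Proof.
rewrite /colouring; case: pickP => [c /forall_inP cP x y Ex Ey xy /= cxy|].
  by have /forall_inP/(_ y Ey) := cP x Ex; rewrite xy cxy eqxx => /eqP.
have [|||c cP] := @bipartite_colouring item ('I_q * 'I_q * 'I_4)%type 'I_q 'I_q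
    (fun x => x.1.1) (fun x => x.1.2) (items (group_counts f)) (2 * (q * q))
    [ffun x => (x.1, ord0)].
- move=> [[j k] t] _ /=; apply: leq_trans (node_load (f, j)).
  rewrite -(card_in_imset (f := packet_item)); last first.
    move=> p p'; rewrite !inE => /andP[Ap /eqP lp] /andP[Ap' /eqP lp'].
    by apply: packet_item_inj; rewrite ?lp ?lp'.
  apply/subset_leq_card/subsetP=> y; rewrite inE => /andP[/packet_item_surj[p Ap [lp <-]]].
  move=> /= /eqP lj; apply/imsetP; exists p => //.
  by rewrite inE Ap -lp -lj -surjective_pairing eqxx.
- move=> [[j k] t] _ /=; apply: leq_trans (key_load f k).
  rewrite -(card_in_imset (f := packet_item)); last first.
    move=> p p'; rewrite !inE => /and3P[Ap /eqP lp _] /and3P[Ap' /eqP lp' _].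
    by apply: packet_item_inj; rewrite ?lp ?lp'.
  apply/subset_leq_card/subsetP=> y; rewrite inE => /andP[/packet_item_surj[p Ap [lp <-]]].
  move=> /= /eqP lj; apply/imsetP; exists p => //.
  by rewrite inE Ap lp lj !eqxx.
- by rewrite !card_prod !card_ord; lia.
move=> /(_ c)/negP[]; apply/forall_inP=> x Ex; apply/forall_inP=> y Ey.
by apply/implyP=> /andP[xy /eqP cxy]; rewrite (cP x y).
Qed.

(** Packets from one node are adjacent edges and have distinct colours; once the relay is fixed,
    only the four labels can tell them apart. The same argument bounds the packets of one group with
    one key. *)
Lemma relay_load_in u v : #|[set p in A | (loc p == u) && (relay p == v)]| <= 4.
Proof.
rewrite -[4]card_ord.
apply: (card_inj_leq (g := fun p => (colouring (group_counts (loc p).1) (packet_item p)).2)).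
move=> p p'; rewrite !inE => /and3P[Ap /eqP lp /eqP rp] /and3P[Ap' /eqP lp' /eqP rp'] eqc.
apply: packet_item_inj; rewrite ?lp ?lp' //; apply: (colouringP (f := (loc p).1)).
- exact: packet_item_in.
- by rewrite lp -lp' packet_item_in.
- by rewrite /= lp lp' eqxx.
move: rp rp' eqc; rewrite /relay lp lp'; set c := colouring _ => r1 r2 e.
by rewrite [LHS]surjective_pairing [RHS]surjective_pairing r1 r2 e.
Qed.

Lemma relay_load_out f j v :
  #|[set p in A | ((loc p).1 == f) && (key p == j) && (relay p == v)]| <= 4.
Proof.
rewrite -[4]card_ord.
apply: (card_inj_leq (g := fun p => (colouring (group_counts (loc p).1) (packet_item p)).2)).
move=> p p'; rewrite !inE -!andbA.
move=> /and4P[Ap /eqP lp /eqP kp /eqP rp] /and4P[Ap' /eqP lp' /eqP kp' /eqP rp'] eqc.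
apply: packet_item_inj; rewrite ?lp ?lp' //; apply: (colouringP (f := (loc p).1)).
- exact: packet_item_in.
- by rewrite lp -lp' packet_item_in.
- by rewrite /= kp kp' eqxx orbT.
move: rp rp' eqc; rewrite /relay lp lp'; set c := colouring _ => r1 r2 e.
by rewrite [LHS]surjective_pairing [RHS]surjective_pairing r1 r2 e.
Qed.

End GroupColouring.

(** * Even spreading of the packets of a node *)

(* A node deals its packets for each destination group round-robin to the q
   groups, and within each group evenly to the nodes. *)
Section Spread.
Variables (q : nat) (P : finType) (dst : P -> 'I_q * 'I_q) (H : {set P}).

Definition spread_group (p : P) : 'I_q :=
  insubd (dst p).1 (rank [set p' in H | (dst p').1 == (dst p).1] p %% q).

(** A node with at most [q * q] packets deals at most [2 * q] to each group, so half the rank is a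
    valid member index and the default of [insubd] is not reached. *)
Definition spread (p : P) : 'I_q * 'I_q :=
  (spread_group p,
   insubd (dst p).1 (rank [set p' in H | spread_group p' == spread_group p] p %/ 2)).

Let q_gt0 (p : P) : 0 < q := leq_ltn_trans (leq0n _) (ltn_ord (dst p).1).

(** Equal ranks modulo [q] have distinct quotients, so a group gets at most one packet more than its
    share. The factor [q] avoids divisions when these bounds are added up. *)
Lemma spread_class h f :
  q * #|[set p in H | ((dst p).1 == h) && (spread_group p == f)]| <=
  #|[set p in H | (dst p).1 == h]| + q.
Proof.
set c := #|[set p in H | (dst p).1 == h]|.
suff : #|[set p in H | ((dst p).1 == h) && (spread_group p == f)]| <= (c %/ q).+1.
  by have := leq_trunc_div c q; rewrite [_ * q]mulnC; nia.
rewrite -[X in _ <= X]card_ord.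
apply: (card_inj_leq (g := fun p => inord (rank [set p' in H | (dst p').1 == h] p %/ q))).
move=> p p'; rewrite !inE => /and3P[Hp /eqP dp /eqP sp] /and3P[Hp' /eqP dp' /eqP sp'].
have rk x : x \in H -> (dst x).1 = h -> rank [set p' in H | (dst p').1 == h] x < c.
  by move=> Hx dx; apply: rank_ltn; rewrite inE Hx dx eqxx.
move/(congr1 (@nat_of_ord _)); rewrite !inordK ?ltnS ?leq_div2r ?(ltnW (rk _ _ _)) // => eq_div.
have /(congr1 (@nat_of_ord _)) := etrans sp (esym sp').
rewrite /spread_group !val_insubd !ltn_pmod ?(q_gt0 p) // dp dp' => eq_mod.
apply: (@rank_inj _ [set p' in H | (dst p').1 == h]); rewrite ?inE ?Hp ?Hp' ?dp ?dp' ?eqxx //.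
by rewrite (divn_eq (rank _ p) q) eq_div eq_mod -divn_eq.
Qed.

Hypothesis H_load : #|H| <= q * q.

(** Adding the round-robin bounds over the destination groups gives q^2 + q^2, hence at most 2q
    packets for one group; halving the ranks puts two on each link. *)
Lemma spread_link w : #|[set p in H | spread p == w]| <= 2.
Proof.
have [->|[p0 _]] := set_0Vmem H; first by rewrite (_ : [set _ in _ | _] = set0) ?cards0 //;
  apply/setP=> p; rewrite !inE.
have q0 := q_gt0 p0.
case: w => f l; rewrite -[2]card_ord.
have load_f : #|[set p in H | spread_group p == f]| <= 2 * q.
  rewrite -(leq_pmul2l q0) (card_fibres _ (fun p => (dst p).1)) big_distrr /=.
  apply: (@leq_trans (\sum_(h < q) (#|[set p in H | (dst p).1 == h]| + q))).
    apply: leq_sum => h _; apply: leq_trans (spread_class h f).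
    rewrite leq_mul2l; apply/orP; right; apply: subset_leq_card.
    by apply/subsetP=> p; rewrite !inE => /andP[/andP[-> ->] ->].
  rewrite big_split /= sum_nat_const card_ord -card_fibres; lia.
apply: (card_inj_leq (g := fun p => inord (rank [set p' in H | spread_group p' == f] p %% 2))).
move=> p p'; rewrite !inE => /andP[Hp /eqP[sp lp]] /andP[Hp' /eqP[sp' lp']].
move/(congr1 (@nat_of_ord _)); rewrite !inordK ?ltn_pmod // => eq_mod.
have rk x : x \in H -> spread_group x = f ->
    rank [set p' in H | spread_group p' == f] x %/ 2 < q.
  move=> Hx dx; rewrite ltn_divLR // mulnC; apply: leq_trans load_f.
  by apply: rank_ltn; rewrite inE Hx dx eqxx.
have /(congr1 (@nat_of_ord _)) := etrans lp (esym lp').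
rewrite !val_insubd sp sp' !rk // => eq_div.
apply: (@rank_inj _ [set p' in H | spread_group p' == f]);
  rewrite ?inE ?Hp ?Hp' ?sp ?sp' ?eqxx //.
by rewrite (divn_eq (rank _ p) 2) eq_div eq_mod -divn_eq.
Qed.

End Spread.

(** * Routing in a constant number of steps *)

Section Routing.
Variables (n b k q : nat) (host : 'I_q * 'I_q -> 'I_n * 'I_k) (P : finType) (r : nat).
Hypothesis host_inj : injective host.
Hypothesis hop_cost : (#|P|.+1 ^ 4).+1 ^ (k * k) <= (2 ^ b) ^ r.
Hypothesis count_cost : (2 * (q * q)).+2 ^ (k * k) <= (2 ^ b) ^ r.
Variables (I S : Type) (X : I -> 'I_q * 'I_q -> S) (A : I -> {set P}).
Variable own : 'I_q * 'I_q -> S -> {set P}.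

(* The counts of a group are gathered by all its members in two steps, through
   the node (j, h) for the packets with key h held by the j-th member. *)
Lemma group_route (loc : I -> P -> 'I_q * 'I_q) (key : P -> 'I_q)
    (sigma : 'I_q -> 'I_q -> 'I_q * 'I_q) :
  (forall i u, own u (X i u) = [set p in A i | loc i p == u]) ->
  (forall i u, #|[set p in A i | loc i p == u]| <= 2 * (q * q)) ->
  (forall i f j,
    #|[set p in A i | ((loc i p).1 == f) && (key p == j)]| <= 2 * (q * q)) ->
  (forall f j f' j', sigma f j = sigma f' j' -> f = f' /\ j = j') ->
  vcomputes b host X (4 * r)
    (fun i w => (X i w, [set p in A i | sigma (loc i p).1 (key p) == w])).
Proof.
move=> ownE load_loc load_key sigma_inj.
have -> : 4 * r = r + (r + (0 + (r + (r + 0)))) by lia.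
have countE i u : group_counts (A i) (loc i) key u.1 =
    [ffun w => inord #|[set p in own (u.1, w.1) (X i (u.1, w.1)) | key p == w.2]|].
  by apply/ffunP=> w; rewrite !ffunE ownE.
(* A node serves all groups at once: it gets one count from each node, and in the next step returns
   one count to each node. *)
apply: vcomputes_trans; first apply: (vcomputes_step host_inj _
    (fun u s w => inord #|[set p in own u s | key p == w.2]| : 'I_(2 * (q * q)).+1)).
  by rewrite card_ord.
apply: vcomputes_trans; first apply: (vcomputes_step host_inj _
    (fun w (s : S * counts q) u => s.2 (u.1, w.1))); first by rewrite card_ord.
apply: vcomputes_trans.
  apply: (@vcomputes_map _ _ _ _ _ _ _ _ _
    (fun i w => (X i w, group_counts (A i) (loc i) key w.1))
    (fun w (s : S * counts q * counts q) => (s.1.1, s.2))).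
  move=> i w /=; rewrite countE; congr pair.
  by apply/ffunP=> u; rewrite !ffunE.
pose out1 u (s : S * counts q) v :=
  [set p in own u s.1 | (colouring s.2 (item_of key (own u s.1) u.2 p)).1 == v].
have out1E i u v : out1 u (X i u, group_counts (A i) (loc i) key u.1) v =
    [set p in A i | (loc i p == u) && (relay (A i) (loc i) key p == v)].
  apply/setP=> p; rewrite !inE ownE inE /= -andbA; apply: andb_id2l => _.
  by rewrite /relay /packet_item; apply: andb_id2l => /eqP <-.
apply: vcomputes_trans; first apply: (vcomputes_hop host_inj (out := out1)) => //.
  by move=> i u v; rewrite out1E relay_load_in.
(* The target depends only on the key and on the group of the holder, which the relay reads off the
   sender [u]. *)
pose out2 (v : 'I_q * 'I_q) (s : S * counts q * {ffun 'I_q * 'I_q -> {set P}}) w :=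
  [set p | [exists u, (p \in s.2 u) && (sigma u.1 (key p) == w)]].
set Y := (X in vcomputes _ _ X).
have out2E i v w : out2 v (Y i v) w = [set p in A i |
    (sigma (loc i p).1 (key p) == w) && (relay (A i) (loc i) key p == v)].
  apply/setP=> p; rewrite !inE; apply/existsP/and3P => [[u]|[Ap sw rv]]; last first.
    by exists (loc i p); rewrite ffunE out1E inE Ap eqxx rv sw.
  by rewrite ffunE out1E !inE => /andP[/and3P[-> /eqP-> ->] ->].
apply: vcomputes_trans; first apply: (vcomputes_hop host_inj (out := out2)) => //.
  move=> i v w; rewrite out2E.
  have [->|[p]] := set_0Vmem [set p in A i |
      (sigma (loc i p).1 (key p) == w) && (relay (A i) (loc i) key p == v)].
    by rewrite cards0.
  rewrite inE => /and3P[_ /eqP pw _].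
  apply: leq_trans (relay_load_out (load_loc i) (load_key i) (loc i p).1 (key p) v).
  apply/subset_leq_card/subsetP=> p'; rewrite !inE => /and3P[-> + ->] /=.
  by rewrite -pw => /eqP/sigma_inj[-> ->]; rewrite !eqxx.
apply: (vcomputes_map _ _ (g := fun w (s : (S * counts q * {ffun 'I_q * 'I_q -> {set P}}) *
    {ffun 'I_q * 'I_q -> {set P}}) => (s.1.1.1, [set p | [exists v, p \in s.2 v]]))).
move=> i w /=; congr pair; apply/setP=> p; rewrite !inE.
apply/andP/existsP => [[Ap sw]|[v]]; last by rewrite ffunE out2E inE => /and3P[-> ->].
by exists (relay (A i) (loc i) key p); rewrite ffunE out2E inE Ap sw eqxx.
Qed.

End Routing.

(** One spreading hop and two group routings of four steps each: 1 + 4 + 4 = 9. *)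
Lemma route n b k q (host : 'I_q * 'I_q -> 'I_n * 'I_k) (P : finType) r
    (I S : Type) (X : I -> 'I_q * 'I_q -> S) (A : I -> {set P})
    (own : 'I_q * 'I_q -> S -> {set P}) (src dst : P -> 'I_q * 'I_q) :
  injective host ->
  (#|P|.+1 ^ 4).+1 ^ (k * k) <= (2 ^ b) ^ r ->
  (2 * (q * q)).+2 ^ (k * k) <= (2 ^ b) ^ r ->
  (forall i u, own u (X i u) = [set p in A i | src p == u]) ->
  (forall i u, #|[set p in A i | src p == u]| <= q * q) ->
  (forall i u, #|[set p in A i | dst p == u]| <= q * q) ->
  vcomputes b host X (9 * r) (fun i w => (X i w, [set p in A i | dst p == w])).
Proof.
move=> host_inj hop_cost count_cost ownE load_src load_dst.
have -> : 9 * r = r + (0 + (4 * r + (4 * r + 0))) by lia.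
pose loc i p := spread dst [set p' in A i | src p' == src p] p.
pose out1 u s w := [set p in own u s | spread dst (own u s) p == w].
have out1E i u w : out1 u (X i u) w = [set p in A i | (src p == u) && (loc i p == w)].
  apply/setP=> p; rewrite !inE ownE inE -andbA; apply: andb_id2l => _.
  by rewrite /loc; apply: andb_id2l => /eqP <-.
have out1_load i u w : #|out1 u (X i u) w| <= 2.
  by rewrite /out1 ownE; apply: spread_link.
have load_loc i w : #|[set p in A i | loc i p == w]| <= 2 * (q * q).
  rewrite (card_fibres _ src).
  apply: leq_trans (_ : \sum_(u : 'I_q * 'I_q) 2 <= _).
    apply: leq_sum => u _; apply: leq_trans (out1_load i u w); rewrite out1E.
    by apply/subset_leq_card/subsetP=> p; rewrite !inE -andbA => /and3P[-> -> ->].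
  by rewrite sum_nat_const card_prod card_ord mulnC.
(* Group [f] gets a [q]-th of the at most q^3 packets for group [h], plus at most one from each of
   the q^2 sources. *)
have load_group i f h :
    #|[set p in A i | ((loc i p).1 == f) && ((dst p).1 == h)]| <= 2 * (q * q).
  have q_gt0 : 0 < q := leq_ltn_trans (leq0n f) (ltn_ord f).
  rewrite -(leq_pmul2l q_gt0) (card_fibres _ src) big_distrr /=.
  apply: (@leq_trans (\sum_u (#|[set p in [set p in A i | (dst p).1 == h] | src p == u]| + q))).
    apply: leq_sum => u _.
    have := spread_class dst [set p in A i | src p == u] h f.
    congr (q * _ <= _ + q); apply: eq_card => p; rewrite !inE /loc.
      case: (eqVneq (src p) u) => [<-|_]; last by rewrite !andbF.
      by rewrite !andbT [X in _ && X]andbC.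
    by rewrite andbAC.
  rewrite big_split /= -card_fibres sum_nat_const card_prod card_ord.
  suff : #|[set p in A i | (dst p).1 == h]| <= q * (q * q) by lia.
  rewrite (card_fibres _ (fun p => (dst p).2)).
  apply: leq_trans (_ : \sum_(j < q) q * q <= _); last by rewrite sum_nat_const card_ord.
  apply: leq_sum => j _; apply: leq_trans (load_dst i (h, j)).
  apply/subset_leq_card/subsetP=> p; rewrite !inE => /andP[/andP[-> /eqP <-] /eqP <-].
  by rewrite -surjective_pairing eqxx.
apply: vcomputes_trans; first apply: (vcomputes_hop host_inj (out := out1)) => //.
  by move=> i u w; apply: leq_trans (out1_load i u w) _.
apply: vcomputes_trans.
  apply: (@vcomputes_map _ _ _ _ _ _ _ _ _ (fun i w => (X i w, [set p in A i | loc i p == w]))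
    (fun w (s : S * {ffun 'I_q * 'I_q -> {set P}}) =>
      (s.1, [set p | [exists u, p \in s.2 u]]))).
  move=> i w /=; congr pair; apply/setP=> p; rewrite !inE.
  apply/andP/existsP => [[Ap lw]|[u]]; last by rewrite ffunE out1E inE => /and3P[-> _ ->].
  by exists (src p); rewrite ffunE out1E inE Ap lw eqxx.
apply: vcomputes_trans.
  apply: (group_route host_inj hop_cost count_cost (own := fun _ s => s.2) (loc := loc)
    (key := fun p => (dst p).1) (sigma := fun f h => (h, f))) => //.
  by move=> f j f' j' [-> ->].
apply: vcomputes_trans.
  (* A packet now sits at [(h, f)], where [h] is its destination group and [f] the group it was
     spread to. *)
  apply: (group_route host_inj hop_cost count_cost (own := fun _ s => s.2)
    (loc := fun i p => ((dst p).1, (loc i p).1)) (key := fun p => (dst p).2)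
    (sigma := fun h j => (h, j))) => //=.
  - move=> i [h f]; apply: leq_trans (load_group i f h).
    apply/subset_leq_card/subsetP=> p; rewrite !inE.
    by move=> /andP[-> /eqP[<- <-]]; rewrite /loc !eqxx.
  - move=> i h j; apply: (@leq_trans (q * q)); last by rewrite leq_pmull.
    apply: leq_trans (load_dst i (h, j)).
    apply/subset_leq_card/subsetP=> p; rewrite !inE => /and3P[-> /eqP <- /eqP <-].
    by rewrite !eqxx.
  - by move=> f j f' j' [-> ->].
apply: (@vcomputes_map _ _ _ _ _ _ _ _ _ _
  (fun w (s : S * {set P} * {set P} * {set P}) => (s.1.1.1, s.2))) => i w /=.
by congr pair; apply/setP=> p; rewrite !inE -surjective_pairing.
Qed.

(** * Simulation of the machine rounds *)

Lemma pmap_onth (T : Type) (s : seq T) m :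
  size s <= m -> pmap (onth s) (iota 0 m) = s.
Proof.
have pmap_mapS (f : nat -> option T) l : pmap f (map succn l) = pmap (f \o succn) l.
  by elim: l => //= x l ->.
elim: m s => [|m IH] [|x s] //= lt_m; rewrite -[1]addn0 iotaDl pmap_mapS.
  by rewrite -[RHS](IH [::]) //; elim: (iota 0 m) => //= y l ->; rewrite onth0n.
by rewrite -[in RHS](IH s).
Qed.

Section Machines.
Variables (Out : Type) (n b k q r : nat) (host : 'I_q * 'I_q -> 'I_n * 'I_k).
Variables (A : mpc_alg Out n) (node : 'I_(mpc_p A) -> 'I_q * 'I_q).
Hypothesis host_inj : injective host.
Hypothesis node_inj : injective node.
Hypothesis space_le : mpc_s A <= q * q.
Hypothesis count_cost : (2 * (q * q)).+2 ^ (k * k) <= (2 ^ b) ^ r.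

Definition machine_state (D : distribution A) (t : nat) (w : 'I_q * 'I_q) :
    option ('I_(mpc_p A) * mpc_data (mpc_p A) (mpc_w A)) :=
  omap (fun j => (j, mpc_run D t j)) [pick j | node j == w].

(** Sender, receiver, position in the list and word; the positions keep equal words apart and
    restore the order. *)
Let packet : finType :=
  ('I_(mpc_p A) * 'I_(mpc_p A) * 'I_(mpc_s A) * word (mpc_w A))%type.

Lemma pick_node j : [pick j' | node j' == node j] = Some j.
Proof.
by case: pickP => [j' /eqP/node_inj->|/(_ j)]; rewrite ?eqxx.
Qed.

Lemma simulate_mpc_round I (D : I -> distribution A) T t :
  (#|packet|.+1 ^ 4).+1 ^ (k * k) <= (2 ^ b) ^ r ->
  (forall i, respects_space (D i) T) -> t < T ->
  vcomputes b host (fun i => machine_state (D i) t) (9 * r)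
                   (fun i => machine_state (D i) t.+1).
Proof.
move=> hop_cost spaceD lt_t; rewrite -[9 * r]addn0.
pose msgs i j j' := mpc_send t j (mpc_run (D i) t j) j'.
pose pk i := [set x : packet | onth (msgs i x.1.1.1 x.1.1.2) x.1.2 == Some x.2].
pose src (x : packet) := node x.1.1.1; pose dst (x : packet) := node x.1.1.2.
pose own (w : 'I_q * 'I_q) (s : option ('I_(mpc_p A) * mpc_data (mpc_p A) (mpc_w A))) :=
  if s is Some jd then [set x : packet | (x.1.1.1 == jd.1) &&
    (onth (mpc_send t jd.1 jd.2 x.1.1.2) x.1.2 == Some x.2)] else set0.
have ownE i w : own w (machine_state (D i) t w) = [set x in pk i | src x == w].
  rewrite /own /machine_state; case: pickP => [j /eqP <-|nj]; apply/setP=> x; last first.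
    by rewrite !inE /src nj andbF.
  rewrite !inE /src (inj_eq node_inj) [RHS]andbC /=; apply: andb_id2l => /eqP E.
  by rewrite /msgs E.
have pk_link i j j' :
    #|[set x in pk i | (x.1.1.1 == j) && (x.1.1.2 == j')]| <= size (msgs i j j').
  set B := [set x in _ | _].
  have inB x : x \in B -> x.1.1 = (j, j') /\ onth (msgs i j j') x.1.2 = Some x.2.
    rewrite !inE => /and3P[/eqP sx /eqP ex1 /eqP ex2].
    by rewrite -ex1 -ex2 -surjective_pairing.
  rewrite cardE -(size_map (fun x : packet => x.1.2 : nat)) -[X in _ <= X](size_iota 0).
  apply: uniq_leq_size.
    rewrite map_inj_in_uniq ?enum_uniq // => x y.
    rewrite !mem_enum => /inB[ex sx] /inB[ey sy] exy.
    have exy' : x.1.2 = y.1.2 by apply: val_inj.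
    have exy'' : x.2 = y.2 by move: sx sy; rewrite exy => -> [].
    rewrite [x]surjective_pairing [y]surjective_pairing exy''.
    by rewrite [x.1]surjective_pairing [y.1]surjective_pairing exy' ex ey.
  move=> _ /mapP[x + ->]; rewrite mem_enum => /inB[_ sx].
  by rewrite mem_iota /= -onthTE sx.
have load_src i u : #|[set x in pk i | src x == u]| <= q * q.
  have [j /eqP <-|no_j] := pickP (fun j => node j == u); last first.
    rewrite (_ : [set _ in _ | _] = set0) ?cards0 //.
    by apply/setP=> x; rewrite !inE /src no_j andbF.
  apply: leq_trans space_le; have [_ /(_ t j lt_t) le_s _] := spaceD i.
  apply: leq_trans le_s; rewrite (card_fibres _ (fun x => x.1.1.2)).
  apply: leq_sum => j' _; apply: leq_trans (pk_link i j j').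
  apply/subset_leq_card/subsetP=> x.
  by rewrite !inE /src (inj_eq node_inj) -andbA => /and3P[-> -> ->].
have load_dst i u : #|[set x in pk i | dst x == u]| <= q * q.
  have [j /eqP <-|no_j] := pickP (fun j => node j == u); last first.
    rewrite (_ : [set _ in _ | _] = set0) ?cards0 //.
    by apply/setP=> x; rewrite !inE /dst no_j andbF.
  (* What is received in round [t] is the inbox of the data at time [t.+1]. *)
  apply: leq_trans space_le; have [_ _ /(_ t.+1 j lt_t) le_s] := spaceD i.
  apply: leq_trans le_s; rewrite (card_fibres _ (fun x => x.1.1.1)) /inbox_size /=.
  apply: leq_sum => j' _; rewrite ffunE; apply: leq_trans (pk_link i j' j).
  apply/subset_leq_card/subsetP=> x.
  by rewrite !inE /dst (inj_eq node_inj) -andbA => /and3P[-> -> ->].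
apply: vcomputes_trans.
  exact: (route host_inj hop_cost count_cost ownE load_src load_dst).
(* Each list is rebuilt position by position; positions past its end carry no packet. *)
pose inbox_of j (R : {set packet}) : {ffun 'I_(mpc_p A) -> seq (word (mpc_w A))} :=
  [ffun j' => pmap (fun y : 'I_(mpc_s A) => [pick x | (j', j, y, x) \in R])
                   (enum 'I_(mpc_s A))].
apply: (vcomputes_map _ _ (g := fun w (s : option ('I_(mpc_p A) * _) * {set packet}) =>
  omap (fun jd => (jd.1, (mpc_keep t jd.1 jd.2, inbox_of jd.1 s.2))) s.1)).
move=> i w; rewrite /machine_state; case: pickP => //= j /eqP nj.
congr (Some (_, (_, _))); apply/ffunP=> j'; rewrite !ffunE.
have le_s : size (msgs i j' j) <= mpc_s A.
  have [_ /(_ t j' lt_t) + _] := spaceD i; apply: leq_trans.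
  by rewrite (bigD1 j) //= leq_addr.
rewrite -[LHS](pmap_onth le_s) -val_enum_ord.
elim: (enum _) => //= y l ->; congr (oapp _ _ _).
case: pickP => [x|].
  by rewrite !inE => /andP[/eqP /= -> _].
case E: (onth _ _) => [x|] // /(_ x); rewrite !inE /= /dst /= nj eqxx andbT.
by move/eqP.
Qed.

Lemma simulate_mpc I (D : I -> distribution A) T :
  (#|packet|.+1 ^ 4).+1 ^ (k * k) <= (2 ^ b) ^ r ->
  (forall i, respects_space (D i) T) ->
  vcomputes b host (fun i => machine_state (D i) 0) (T * (9 * r))
                   (fun i => machine_state (D i) T).
Proof.
move=> hop_cost spaceD.
suff : forall t, t <= T -> vcomputes b host (fun i => machine_state (D i) 0) (t * (9 * r))
    (fun i => machine_state (D i) t) by apply.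
elim=> [_|t IH lt_t]; first exact: (vcomputes_map _ _ (g := fun _ s => s)).
rewrite mulSn addnC; apply: vcomputes_trans (IH (ltnW lt_t)) _.
exact: simulate_mpc_round spaceD lt_t.
Qed.

End Machines.

(** * Initial distribution of the edges *)

Section EdgeRank.
Variables (n : nat).
Implicit Types (G : sgraph n) (N : {set 'I_n}) (v : 'I_n) (e : 'I_n * 'I_n).

Definition above N v : {set 'I_n} := [set u in N | v < u].

Definition up_degrees G : {ffun 'I_n -> 'I_n.+1} :=
  [ffun v => inord #|above (neighbours G v) v|].

(* Position of e in the lexicographic order of the edges, which the lower endpoint
   of e computes from its own neighbours N and the list d of up-degrees. *)
Definition edge_rank (d : {ffun 'I_n -> 'I_n.+1}) N e : nat :=
  \sum_(v < n | v < e.1) d v + rank (above N e.1) e.2.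

Lemma up_degreesE G v : up_degrees G v = #|above (neighbours G v) v| :> nat.
Proof. by rewrite ffunE inordK // ltnS -[X in _ <= X](card_ord n) max_card. Qed.

Lemma edges_above G e : (e \in edges G) = (e.2 \in above (neighbours G e.1) e.1).
Proof. by rewrite !inE andbC. Qed.

Lemma nb_edgesE G : nb_edges G = \sum_v up_degrees G v.
Proof.
rewrite /nb_edges (card_fibres _ fst); apply: eq_bigr => v _.
rewrite up_degreesE -[RHS](card_imset _ (f := fun u => (v, u))); last by move=> ? ? [].
apply: eq_card => -[v' u]; rewrite inE edges_above /=.
apply/andP/imsetP => [[abv /eqP <-]|[x abv [-> ->]]]; last by rewrite abv.
by exists u.
Qed.

Let erank G e := edge_rank (up_degrees G) (neighbours G e.1) e.

(** The edges with a given lower endpoint occupy an interval of ranks as long as its up-degree, and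
    these intervals follow one another. *)
Lemma edge_rank_lower G e v : e \in edges G -> e.1 < v ->
  erank G e < \sum_(u < n | u < v) up_degrees G u.
Proof.
rewrite edges_above => /rank_ltn; rewrite -up_degreesE => lt_e ev.
rewrite (bigID (fun u : 'I_n => u < e.1)) /= [X in _ < _ + X](bigD1 e.1) ?ev ?ltnn //=.
rewrite /erank /edge_rank; under [X in _ < X + _]eq_bigl => u.
  rewrite (_ : (u < v) && (u < e.1) = (u < e.1)); first over.
  by case: (ltnP u e.1) => [/ltn_trans/(_ ev)->|_]; rewrite ?andbF.
by rewrite ltn_add2l ltn_addr.
Qed.

Lemma edge_rank_ltn G e : e \in edges G -> erank G e < nb_edges G.
Proof.
rewrite edges_above => /rank_ltn; rewrite -up_degreesE => lt_e.
rewrite nb_edgesE (bigID (fun u : 'I_n => u < e.1)) /= [X in _ < _ + X](bigD1 e.1) ?ltnn //=.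
by rewrite /erank /edge_rank ltn_add2l ltn_addr.
Qed.

Lemma edge_rank_inj G : {in edges G &, injective (erank G)}.
Proof.
move=> e e' Ee Ee' eq_rk.
have eq1 : e.1 = e'.1.
  apply: val_inj; case: (ltngtP e.1 e'.1) => // [/(edge_rank_lower Ee)|/(edge_rank_lower Ee')].
    by rewrite eq_rk /erank /edge_rank ltnNge leq_addr.
  by rewrite -eq_rk /erank /edge_rank ltnNge leq_addr.
move: eq_rk; rewrite /erank /edge_rank -eq1 => /addnI/rank_inj eq2.
rewrite [e]surjective_pairing [e']surjective_pairing -eq1 eq2 -?edges_above //.
by rewrite eq1 -edges_above.
Qed.

(** Machines are filled in rank order with [mpc_s A] edges each, so that the lower endpoint of an
    edge can compute its machine. *)
Definition edge_distribution Out (A : mpc_alg Out n) G : distribution A :=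
  fun j => [set e in edges G | erank G e %/ mpc_s A == j].
Global Arguments edge_distribution {Out} A G.

Lemma edge_distribution_admissible Out (A : mpc_alg Out n) G :
  nb_edges G <= mpc_p A * mpc_s A -> admissible G (edge_distribution A G).
Proof.
move=> cap; split=> [j|e Ee|j].
- by apply/subsetP=> e; rewrite inE => /andP[].
- have lt_e := leq_trans (edge_rank_ltn Ee) cap.
  have s_gt0 : 0 < mpc_s A by move: lt_e; case: (mpc_s A) => //; rewrite muln0.
  have lt_p : erank G e %/ mpc_s A < mpc_p A by rewrite ltn_divLR.
  exists (Ordinal lt_p); split; first by rewrite inE Ee /=.
  by move=> j; rewrite inE => /andP[_ /eqP ej]; apply: val_inj.
have [->|[e0]] := set_0Vmem (edge_distribution A G j); first by rewrite cards0.
rewrite inE => /andP[Ee0 _]; have lt_e := leq_trans (edge_rank_ltn Ee0) cap.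
have s_gt0 : 0 < mpc_s A by move: lt_e; case: (mpc_s A) => //; rewrite muln0.
rewrite -[X in _ <= X]card_ord.
apply: (card_inj_leq (g := fun e => Ordinal (ltn_pmod (erank G e) s_gt0))) => e e'.
rewrite inE => /andP[Ee /eqP je]; rewrite inE => /andP[Ee' /eqP je'] [eq_mod].
apply: (edge_rank_inj Ee Ee'); rewrite -/(erank G e) -/(erank G e').
by rewrite (divn_eq (erank G e) (mpc_s A)) je eq_mod -je' -divn_eq.
Qed.

(** Each edge is routed from [rep] of its lower endpoint, a single source, to the node of its
    machine. A source has at most [n] edges and a target at most [mpc_s A], both within the routing
    load. *)
Lemma load_edges Out (A : mpc_alg Out n) b k q r (host : 'I_q * 'I_q -> 'I_n * 'I_k)
    (rep : 'I_n -> 'I_q * 'I_q) (node : 'I_(mpc_p A) -> 'I_q * 'I_q)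
    I (gr : I -> sgraph n) :
  injective host -> injective node -> (forall v, (host (rep v)).1 = v) ->
  n <= q * q -> mpc_s A <= q * q ->
  (forall i, nb_edges (gr i) <= mpc_p A * mpc_s A) ->
  (#|{: 'I_(mpc_p A) * ('I_n * 'I_n)}|.+1 ^ 4).+1 ^ (k * k) <= (2 ^ b) ^ r ->
  (2 * (q * q)).+2 ^ (k * k) <= (2 ^ b) ^ r ->
  vcomputes b host
    (fun i w => (neighbours (gr i) (host w).1, up_degrees (gr i))) (9 * r)
    (fun i => machine_state node (edge_distribution A (gr i)) 0).
Proof.
move=> host_inj node_inj repK le_n le_s cap hop_cost count_cost; rewrite -[9 * r]addn0.
pose packet : finType := ('I_(mpc_p A) * ('I_n * 'I_n))%type.
pose src (x : packet) := rep x.2.1; pose dst (x : packet) := node x.1.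
pose pk i := [set x : packet | x.2 \in edge_distribution A (gr i) x.1].
pose own (w : 'I_q * 'I_q) (s : {set 'I_n} * {ffun 'I_n -> 'I_n.+1}) :=
  [set x : packet | [&& src x == w, x.2.2 \in above s.1 x.2.1 &
     edge_rank s.2 s.1 x.2 %/ mpc_s A == x.1]].
apply: vcomputes_trans.
  apply: (route host_inj hop_cost count_cost (A := pk) (own := own) (src := src) (dst := dst)).
  - move=> i u; apply/setP=> x; rewrite !inE [RHS]andbC; apply: andb_id2l => /eqP <-.
    by rewrite /src repK [X in X && _]andbC.
  - move=> i u; apply: leq_trans le_n; rewrite -[X in _ <= X]card_ord.
    apply: (card_inj_leq (g := fun x : packet => x.2.2)) => -[j [v w]] [j' [v' w']].
    rewrite inE => /andP[Ex /eqP sx]; rewrite inE => /andP[Ex' /eqP sx'] /= eq2.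
    have /(congr1 (fun u => (host u).1)) := etrans sx (esym sx').
    rewrite /src !repK /= => eq1; move: Ex Ex'; rewrite -eq1 -eq2 !inE.
    move=> /andP[_ /eqP jE] /andP[_ /eqP jE'].
    by congr (_, _); apply: val_inj; rewrite /= -jE -jE'.
  - move=> i u; have [j /eqP <-|no_j] := pickP (fun j => node j == u); last first.
      rewrite (_ : [set _ in _ | _] = set0) ?cards0 //.
      by apply/setP=> x; rewrite !inE /dst no_j andbF.
    apply: leq_trans le_s.
    have [_ _ /(_ j)] := edge_distribution_admissible (cap i); apply: leq_trans.
    rewrite -(card_in_imset (f := fun x : packet => x.2)); last first.
      move=> [j1 e] [j2 e']; rewrite inE => /andP[_ /eqP/node_inj /= ->].
      by rewrite inE => /andP[_ /eqP/node_inj /= ->] ->.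
    apply/subset_leq_card/subsetP=> _ /imsetP[x + ->].
    by rewrite inE => /andP[+ /eqP/node_inj jE]; rewrite -jE inE.
pose load (j : 'I_(mpc_p A)) (R : {set packet}) :
    'I_(mpc_p A) * mpc_data (mpc_p A) (mpc_w A) :=
  (j, (mpc_load j [set e | (j, e) \in R], [ffun => [::]])).
apply: (vcomputes_map _ _ (g := fun w (s : {set 'I_n} * {ffun 'I_n -> 'I_n.+1} * {set packet}) =>
  omap (fun j => load j s.2) [pick j | node j == w])).
move=> i w; rewrite /machine_state; case: pickP => //= j /eqP nj.
congr (Some (_, (mpc_load _ _, _))); apply/setP=> e.
rewrite !inE /dst /= nj eqxx andbT; reflexivity.
Qed.

End EdgeRank.

(** * Choice of the virtual clique *)

Lemma square_approx x : exists q, x <= q * q <= 4 * x.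
Proof.
have ex_q : exists q, x <= q * q by exists x; nia.
(* For the least q, if q >= 2 then q^2 <= 4(q - 1)^2 < 4x. *)
exists (ex_minn ex_q); case: ex_minnP => q le_x min_q; rewrite le_x /=.
case: q le_x min_q => [//|[|q]] le_x min_q.
  by case: x le_x min_q {ex_q} => [|x] _ min_q; [have := min_q 0 isT|lia].
have : q.+1 * q.+1 < x by rewrite ltnNge; apply/negP=> /min_q; rewrite ltnn.
nia.
Qed.

(** Virtual nodes are dealt cyclically: the residue of the rank modulo [n] is the host and the
    quotient is the slot. The first [n] serve as representatives. *)
Lemma host_exists n k (W : finType) :
  0 < n -> n <= #|W| -> #|W| <= n * k ->
  exists (host : W -> 'I_n * 'I_k) (rep : 'I_n -> W),
    injective host /\ forall v, (host (rep v)).1 = v.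
Proof.
move=> n_gt0 le_n le_W.
have lt_k (w : W) : enum_rank w %/ n < k.
  by rewrite ltn_divLR // mulnC (leq_trans _ le_W).
exists (fun w => (Ordinal (ltn_pmod (enum_rank w) n_gt0), Ordinal (lt_k w))).
exists (fun v => enum_val (widen_ord le_n v)); split=> [w w' [eq_mod eq_div]|v].
  apply: enum_rank_inj; apply: val_inj; rewrite /=.
  by rewrite (divn_eq (enum_rank w) n) eq_mod eq_div -divn_eq.
by apply: val_inj; rewrite /= enum_valK /= modn_small.
Qed.

Lemma sum_pick (T U : finType) (g : T -> U) (F : T -> nat) : injective g ->
  \sum_u oapp F 0 [pick x | g x == u] = \sum_x F x.
Proof.
move=> g_inj; rewrite (partition_big g xpredT) //=; apply: eq_bigr => u _.
case: pickP => [x /eqP <-|no_x] /=; last by rewrite big_pred0.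
by rewrite (eq_bigl (pred1 x)) ?big_pred1_eq // => y; rewrite /= (inj_eq g_inj).
Qed.

Lemma count_flatten_enum (T : finType) (Out : Type) (P : pred Out) (F : T -> seq Out) :
  count P (flatten [seq F x | x <- enum T]) = \sum_x count P (F x).
Proof. by rewrite count_flatten -map_comp sumnE big_map big_enum. Qed.

(** * Bit costs of the messages *)

Section Costs.
Variables (a b c n : nat).
Hypothesis n_gt0 : 0 < n.

(** All alphabets are compared with powers of [y]; constants are absorbed by bounds such as c <
    y^c. *)
Let y := 2 ^ logw n.

Let lt_n : n < y.
Proof. exact: up_logP. Qed.

Let y_gt1 : 1 < y. Proof. exact: leq_trans lt_n. Qed.

Let succ_le x i : x <= y ^ i -> x.+1 <= y ^ i.+1.
Proof. by have := expn_gt0 y i; rewrite expnS; nia. Qed.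

Let space_le x : x <= c * n -> x <= y ^ c.+1.
Proof.
move/leq_trans; apply; rewrite expnSr leq_mul // ltnW //.
exact: ltn_expl.
Qed.

Let cost_le x k : 0 < b -> x <= y ^ (12 * c + 4 * a + 17) ->
  x ^ k <= (2 ^ (b * logw n)) ^ ((12 * c + 4 * a + 17) * k).
Proof.
move=> b_gt0 le_x; rewrite expnM; case: k => [|k]; first by rewrite !expn0.
rewrite leq_exp2r //; apply: leq_trans le_x _; rewrite leq_exp2r ?addn_gt0 ?orbT //.
by rewrite leq_exp2l // leq_pmull.
Qed.

(** Each successor raises the exponent by at most one: 4(3c + a + 3 + 1) + 1 = 12c + 4a + 17. *)
Lemma packet_cost (P : finType) k : 0 < b -> #|P| <= y ^ (3 * c + a + 3) ->
  (#|P|.+1 ^ 4).+1 ^ k <= (2 ^ (b * logw n)) ^ ((12 * c + 4 * a + 17) * k).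
Proof.
move=> b_gt0 leP; apply: cost_le => //.
rewrite (_ : 12 * c + 4 * a + 17 = ((3 * c + a + 3).+1 * 4).+1); last lia.
by apply: succ_le; rewrite expnM leq_exp2r // succ_le.
Qed.

Lemma count_cost q k : 0 < b -> q * q <= 4 * (c.+1 * n) ->
  (2 * (q * q)).+2 ^ k <= (2 ^ (b * logw n)) ^ ((12 * c + 4 * a + 17) * k).
Proof.
move=> b_gt0 q_le; apply: cost_le => //.
have le8 : 2 * (q * q) <= y ^ (3 + c.+1 + 1).
  apply: (@leq_trans (2 ^ 3 * c.+1 * n)); first by lia.
  rewrite !expnD expn1 !leq_mul //; last exact: ltnW.
  by apply: ltn_trans (ltn_expl _ y_gt1).
apply: leq_trans (succ_le (succ_le le8)) _; rewrite leq_exp2l //; lia.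
Qed.

Lemma message_packets p s w : p <= c * n -> s <= c * n -> w <= a * logw n ->
  #|{: 'I_p * 'I_p * 'I_s * word w}| <= y ^ (3 * c + a + 3).
Proof.
move=> /space_le le_p /space_le le_s le_w.
rewrite !card_prod !card_ord card_tuple card_bool.
rewrite (_ : 3 * c + a + 3 = c.+1 + c.+1 + c.+1 + a); last lia.
by rewrite !(expnD y) !leq_mul // -expnM mulnC leq_exp2l.
Qed.

Lemma edge_packets p : p <= c * n ->
  #|{: 'I_p * ('I_n * 'I_n)}| <= y ^ (3 * c + a + 3).
Proof.
move=> /space_le le_p; rewrite !card_prod !card_ord.
apply: (@leq_trans (y ^ c.+1 * (y ^ 1 * y ^ 1))).
  by rewrite !leq_mul // expn1 ltnW.
rewrite -!expnD leq_exp2l //; lia.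
Qed.

End Costs.

(** * Assembly of the simulation *)

Definition clique_rounds (a c T : nat) : nat :=
  let r := (12 * c + 4 * a + 17) * (4 * c.+1 * (4 * c.+1)) in 1 + (9 * r + T * (9 * r)).

Lemma simulate_size (a b c n : nat) (Out : eqType) (A : nat -> mpc_alg Out n) T :
  0 < b ->
  (forall G : sgraph n, mpc_w (A (nb_edges G)) <= a * logw n) ->
  (forall G : sgraph n, mpc_s (A (nb_edges G)) <= c * n) ->
  (forall G : sgraph n, mpc_p (A (nb_edges G)) <= mpc_s (A (nb_edges G))) ->
  (forall G : sgraph n,
    nb_edges G <= mpc_p (A (nb_edges G)) * mpc_s (A (nb_edges G))) ->
  (forall (G : sgraph n) (D : distribution (A (nb_edges G))),
    admissible G D -> respects_space D T) ->
  exists B : cc_alg Out n (b * logw n), forall G,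
    exists2 D : distribution (A (nb_edges G)), admissible G D &
      perm_eq (cc_output B G (clique_rounds a c T)) (mpc_output D T).
Proof.
move=> b_gt0 word_le space_le mach_le capacity spaceT.
(* With no vertices there is no local space, hence no machine, and both outputs are empty. *)
have [n0|n_gt0] := posnP n.
  exists (CcAlg (fun _ _ => tt) (fun _ _ _ => None) (fun _ _ _ => tt) (fun _ _ => [::])).
  move=> G; exists (edge_distribution (A (nb_edges G)) G).
    exact: edge_distribution_admissible.
  have p0 : mpc_p (A (nb_edges G)) = 0.
    by apply/eqP; rewrite -leqn0 (leq_trans (mach_le G)) // (leq_trans (space_le G)) // n0 muln0.
  rewrite /cc_output /mpc_output.
  have /size0nil-> : size (enum 'I_n) = 0 by rewrite size_enum_ord.
  by have /size0nil-> : size (enum 'I_(mpc_p (A (nb_edges G)))) = 0 by rewrite size_enum_ord.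
set r := (12 * c + 4 * a + 17) * (4 * c.+1 * (4 * c.+1)).
(* The factor [c.+1] makes [q * q] at least both [n] and [c * n]. *)
have [q /andP[q_ge q_le]] := square_approx (c.+1 * n).
have le_n : n <= q * q by apply: leq_trans q_ge; rewrite leq_pmull.
have le_cn : c * n <= q * q by apply: leq_trans q_ge; rewrite leq_mul.
have [||host [rep [host_inj repK]]] := @host_exists n (4 * c.+1) ('I_q * 'I_q)%type n_gt0.
- by rewrite card_prod card_ord.
- by rewrite card_prod card_ord; lia.
pose node m (j : 'I_(mpc_p (A m))) : 'I_q * 'I_q :=
  nth (rep (Ordinal n_gt0)) (enum {: 'I_q * 'I_q}) j.
have node_inj (G : sgraph n) : injective (@node (nb_edges G)).
  have lt_j (j : 'I_(mpc_p (A (nb_edges G)))) : j < size (enum {: 'I_q * 'I_q}).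
    rewrite -cardE card_prod card_ord (leq_trans (ltn_ord j)) //.
    exact: leq_trans (mach_le G) (leq_trans (space_le G) le_cn).
  by move=> j j' /eqP; rewrite nth_uniq ?enum_uniq // => /eqP/val_inj.
pose st m t (G : sgraph n) := machine_state (@node m) (edge_distribution (A m) G) t.
pose item m (s : option (option ('I_(mpc_p (A m)) * mpc_data _ _))) : seq Out :=
  if s is Some (Some jd) then mpc_out jd.1 jd.2 else [::].
pose out m (x : {ffun 'I_(4 * c.+1) -> _}) : seq Out :=
  flatten [seq item m (x l) | l <- enum 'I_(4 * c.+1)].
pose X (G : sgraph n) v := out (nb_edges G) (hosted host (st (nb_edges G) T) G v).
have XE G v m : nb_edges G = m -> X G v = out m (hosted host (st m T) G v) by move=> <-.
have compX : computes (b * logw n) (@neighbours n) (clique_rounds a c T) X.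
  (* An up-degree has [n.+1] possible values and fits in one message, so one round broadcasts them
     all. *)
  apply: computes_trans; first apply: (computes_step _
      (fun (v : 'I_n) N _ => inord #|above N v| : 'I_n.+1)).
    rewrite card_ord expn1; apply: leq_trans (_ : 2 ^ logw n <= _).
      exact: up_logP.
    by rewrite leq_exp2l // leq_pmull.
  (* The program depends on the number of edges, which every node now knows as the sum of the
     up-degrees. *)
  apply: (computes_fiber (k := @nb_edges n) (g := fun x : {set 'I_n} * {ffun 'I_n -> 'I_n.+1} =>
    \sum_v x.2 v)).
    by move=> G v; rewrite nb_edgesE.
  move=> m; pose I := {G : sgraph n | nb_edges G = m}.
  have word_m (i : I) : mpc_w (A m) <= a * logw n by case: i => G <-.
  have space_m (i : I) : mpc_s (A m) <= c * n by case: i => G <-.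
  have mach_m (i : I) : mpc_p (A m) <= c * n.
    by case: i => G <-; apply: leq_trans (mach_le G) (space_le G).
  have cap_m (i : I) : nb_edges (sval i) <= mpc_p (A m) * mpc_s (A m)
    by case: i => G /= <-.
  have space_T (i : I) : respects_space (edge_distribution (A m) (sval i)) T.
    by case: i => G /= <-; apply/spaceT/edge_distribution_admissible.
  have node_m (i : I) : injective (@node m) by case: i => G <-.
  (* The bounds on [A m] come from a graph with [m] edges; without one there is nothing to
     compute. *)
  have [[i0]|no_i] := pselect (inhabited I); last first.
    by exists (fun _ _ _ _ => None), (fun _ _ _ => [::]) => i; case: no_i; constructor.
  have count := count_cost a n_gt0 (4 * c.+1 * (4 * c.+1)) b_gt0 q_le.
  rewrite -[9 * r + _]add0n -[X in computes _ _ X]addn0.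
  apply: computes_trans.
    apply: (@computes_trans _ _ _ _ _ _ _ (hosted host (fun (i : I) w =>
      (neighbours (sval i) (host w).1, up_degrees (sval i))))).
      apply: (computes_map _ (g := fun v x => [ffun l =>
        omap (fun w => (x.1, x.2)) [pick w | host w == (v, l)]])).
      move=> i v; apply/ffunP=> l; rewrite !ffunE; case: pickP => //= w /eqP ->.
      by [].
    apply: (@vcomputes_trans n _ _ _ host I _ _ _ _ (fun i : I => st m 0 (sval i))).
      apply: (load_edges host_inj (node_m i0) repK) => //.
      - by apply: leq_trans (space_m i0) le_cn.
      - by apply: packet_cost => //; apply: edge_packets => //; apply: mach_m.
    apply: (simulate_mpc host_inj (node_m i0)) => //.
    - by apply: leq_trans (space_m i0) le_cn.
    - apply: packet_cost => //.
      by apply: message_packets => //; [apply: mach_m|apply: space_m|apply: word_m].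
  apply: (computes_map _ (g := fun v x => out m x)).
  by move=> i v; rewrite (XE _ _ m (svalP i)).
have [B outB] := computes_cc compX.
exists B => G; exists (edge_distribution (A (nb_edges G)) G).
  exact: edge_distribution_admissible.
(* Both outputs are compared by counting: the sum over slots becomes one over virtual nodes, then
   one over machines. *)
apply/permP=> P; rewrite /cc_output /mpc_output !count_flatten_enum.
under eq_bigr => v _ do rewrite outB /X /out count_flatten_enum.
rewrite pair_bigA /=.
pose F (w : 'I_q * 'I_q) := oapp (fun j =>
   count P (mpc_out j (mpc_run (edge_distribution (A (nb_edges G)) G) T j))) 0
   [pick j | @node (nb_edges G) j == w].
rewrite -(sum_pick (fun j => _) (node_inj G)) -(sum_pick F host_inj).
apply: eq_bigr => -[v l] _; rewrite ffunE /=.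
by case: pickP => //= w _; rewrite /F /st /machine_state; case: pickP.
Qed.

(* a, b, c are the constants hidden in the semi-MPC word size, the congested
   clique message size and the semi-MPC local space; the constant C of the round
   bound depends on nothing else. *)
Theorem theorem3p2 (a b c : nat) (hb : 0 < b) :
  exists C : nat,
    forall (R : realType) (delta : R) (Out : eqType)
           (A : forall n m : nat, mpc_alg Out n) (T : nat -> nat),
      (0 <= delta < 1)%R ->
      (forall n, 0 < T n) ->
      semi_mpc delta a c A T ->
      exists (B : forall n : nat, cc_alg Out n (b * logw n)) (r : nat -> nat),
        (forall n, r n <= C * T n) /\ simulates B r A T.
Proof.
exists (clique_rounds a c 1) => R delta Out A T _ T_gt0 simA.
have simn n := simulate_size hb (semi_mpc_word simA (n := n)) (semi_mpc_space simA (n := n))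
  (semi_mpc_machines simA (n := n)) (semi_mpc_capacity simA (n := n))
  (semi_mpc_rounds simA (n := n)).
exists (fun n => projT1 (cid (simn n))), (fun n => clique_rounds a c (T n)); split.
  (* The round count is affine in [T n], and [T n] is at least 1. *)
  by move=> n; have := T_gt0 n; rewrite /clique_rounds; nia.
by move=> n; case: (cid (simn n)).
Qed.
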